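(* Let $(H,\omega)$ be a real symplectic Hilbert space with $\omega(x,y)=\langle Jx,y\rangle$, $J^2=-I$, $J^t=-J$, and let $(\lambda,\mu)$ be any pair of (real) Lagrangian subspaces of $H$. Let $\widetilde V\colon H\to H$ with $\widetilde VJ=J\widetilde V$ be a real generating operator for $\mu$ with respect to the orthogonal splitting $H=\lambda\oplus J\lambda$. Let $U,V\colon H^+\to H^-$ denote the unitary generating operators for $\lambda\otimes\mathbb C$ and $\mu\otimes\mathbb C$, i.e. $\lambda\otimes\mathbb C=\mathfrak G(U)$ and $\mu\otimes\mathbb C=\mathfrak G(V)$. Then $$VU^{-1}=-\overline{S_\lambda(\widetilde V)},$$ where $S_\lambda(\widetilde V)$ denotes the complex generating operator for $\mu\otimes\mathbb C$ with respect to $\lambda$.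
   Context: $H\otimes\mathbb C$ carries the complex-linear extension of $J$, the induced Hermitian inner product and the form $\omega_{\mathbb C}(x,y)=\langle Jx,y\rangle$; $H^\pm:=\{(I\mp iJ)\zeta:\zeta\in H\}$ gives a symplectic splitting $H\otimes\mathbb C=H^+\oplus H^-$. $\mathfrak G(U)=\{x+Ux:x\in H^+\}$ is the graph of $U$. A subspace $\lambda\subset H$ is Lagrangian if it equals its $\omega$-annihilator (equivalently $\lambda^\perp=J\lambda$). Fix a Lagrangian $\lambda\subset H$. Let $\varphi\colon H\to\lambda\otimes\mathbb C$ be the real linear isomorphism $\varphi(x+Jy):=x+iy$, $x,y\in\lambda$. For $A=X+JY\colon H\to H$ with $X,Y\colon H\to H$ real linear, $X(\lambda)\subset\lambda$, $Y(\lambda)\subset\lambda$, $XJ=JX$, $YJ=JY$, put $\varphi_*(A):=\varphi\circ A\circ\varphi^{-1}=X+iY$ and $A^{t_\lambda}:=X^t+JY^t$, where $X^t,Y^t$ are the real transposes. A real generating operator for $\mu$ with respect to $H=\lambda\oplus J\lambda$ is $\widetilde V\colon H\to H$ with $\widetilde VJ=J\widetilde V$, $\mu=\widetilde V(J\lambda)$ and $\varphi_*(\widetilde V)$ unitary. The complex generating operator is $S_\lambda(\widetilde V):=\varphi_*(\widetilde V)\,\varphi_*(\widetilde V^{t_\lambda})$. Interpretation of the right-hand side as an operator on $H^-$: writing $\widetilde V\widetilde V^{t_\lambda}=X+JY$ with $X,Y$ real linear, commuting with $J$ and preserving $\lambda$, one has $S_\lambda(\widetilde V)=X+iY$, and $\overline{S_\lambda(\widetilde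 V)}:=X-iY$ acts on $H^-\subset H\otimes\mathbb C$ via the complex-linear extensions of $X,Y$ to $H\otimes\mathbb C$ (which preserve $H^-$). *)

(* Defs.v *)
From HB Require Import structures.
From mathcomp Require Import all_boot all_order all_algebra sesquilinear.
From mathcomp Require Import complex.
From mathcomp Require Import boolp classical_sets functions reals topology normedtype.

Set Implicit Arguments.
Unset Strict Implicit.
Unset Printing Implicit Defensive.

Import Order.TTheory GRing.Theory Num.Theory.
Import numFieldNormedType.Exports.

Local Open Scope ring_scope.
Local Open Scope complex_scope.

Local Notation Re := complex.Re.
Local Notation Im := complex.Im.

(* Completeness comes from [CompleteNormedModule]. *)
HB.mixin Record isHilbert (R : realType) H of CompleteNormedModule R H := {
  dot : {dot H for (@idfun R)};
  normr_dot : forall x : H, `|x| ^+ 2 = dot x x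
}.

#[short(type="hilbertType")]
HB.structure Definition Hilbert (R : realType) :=
  {H of CompleteNormedModule R H & isHilbert R H}.

(* [J] is not required to be bounded: being skew with square [-1], it is an
   isometry. *)
HB.mixin Record isSymplectic (R : realType) H of Hilbert R H := {
  J : {linear H -> H};
  J_sqr : forall x : H, J (J x) = - x;
  J_skew : forall x y : H, dot (J x) y = - dot x (J y)
}.

#[short(type="symplecticHilbertType")]
HB.structure Definition SymplecticHilbert (R : realType) :=
  {H of Hilbert R H & isSymplectic R H}.

(* The subspace defined by a closed predicate, as a module of its own. *)
Section Subspace.
Variables (K : nzRingType) (E : lmodType K).

Definition subsp (S : submodClosed E) : Type := {x : E | x \in S}.

Variable S : submodClosed E.
HB.instance Definition _ := SubChoice.on (subsp S).
HB.instance Definition _ := [SubChoice_isSubLmodule of subsp S by <:].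
End Subspace.

(* [(x, y) : cplx V] stands for [x + i y]. *)
Definition cplx (R : realType) (V : lmodType R) : Type := (V * V)%type.

Section Complexification.
Variables (R : realType) (V : lmodType R).

HB.instance Definition _ := GRing.Zmodule.on (cplx V).

Definition cscale (c : R[i]) (z : cplx V) : cplx V :=
  (Re c *: z.1 - Im c *: z.2, Re c *: z.2 + Im c *: z.1).

Fact cscaleA a b z : cscale a (cscale b z) = cscale (a * b) z.
Proof.
case: a b z => [a a'] [b b'] [x y]; rewrite /cscale /=; congr pair.
  rewrite !scalerBr !scalerDr !scalerA !scalerBl !scalerDl.
  by rewrite !opprD !addrA [LHS]addrAC; congr (_ + _); rewrite addrAC.
rewrite !scalerDr !scalerN !scalerA !scalerBl !scalerDl.
by rewrite !addrA [LHS]addrAC; congr (_ + _); rewrite addrAC.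
Qed.

Fact cscale1 : left_id 1 cscale.
Proof. by case=> x y; rewrite /cscale /= !scale0r !scale1r subr0 addr0. Qed.

Fact cscaleDr : right_distributive cscale +%R.
Proof.
move=> c [x y] [x' y']; rewrite /cscale /=; congr pair.
  by rewrite !scalerDr opprD !addrA; congr (_ + _); rewrite addrAC.
by rewrite !scalerDr !addrA; congr (_ + _); rewrite addrAC.
Qed.

Fact cscaleDl z : {morph cscale^~ z : a b / a + b}.
Proof.
case: z => x y [a a'] [b b']; rewrite /cscale /=; congr pair.
  by rewrite !scalerDl opprD !addrA; congr (_ + _); rewrite addrAC.
by rewrite !scalerDl !addrA; congr (_ + _); rewrite addrAC.
Qed.

HB.instance Definition _ := GRing.Zmodule_isLmodule.Build R[i] (cplx V)
  cscaleA cscale1 cscaleDr cscaleDl.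
End Complexification.

Section ComplexifiedMaps.
Variables (R : realType) (V : lmodType R).

Definition iota (x : V) : cplx V := (x, 0).

(* The complex-linear extension of [A]. *)
Definition cext (A : V -> V) (z : cplx V) : cplx V := (A z.1, A z.2).
End ComplexifiedMaps.

(* [<a + ib, c + id>], linear in the first argument and antilinear in the
   second. *)
Definition cdot (R : realType) (H : hilbertType R) (z w : cplx H) : R[i] :=
  (dot z.1 w.1 + dot z.2 w.2) +i* (dot z.2 w.1 - dot z.1 w.2).

Section Symplectic.
Variables (R : realType) (H : symplecticHilbertType R).

Definition omega (x y : H) : R := dot (J x) y.

Definition lagrangian (L : submodClosed H) : Prop :=
  forall x, x \in L <-> (forall y, y \in L -> omega x y = 0).

Definition Hplus_pred : pred (cplx H) := fun z =>
  `[< exists zeta : H, z = iota zeta - 'i *: cext J (iota zeta) >].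

Definition Hminus_pred : pred (cplx H) := fun z =>
  `[< exists zeta : H, z = iota zeta + 'i *: cext J (iota zeta) >].

Fact Hplus_predP z : (z \in Hplus_pred) = (z.2 == - J z.1).
Proof.
have E zeta : iota zeta - 'i *: cext J (iota zeta) = (zeta, - J zeta) :> cplx H.
  congr pair => /=; first by rewrite linear0 scale0r scaler0 !subr0.
  by rewrite linear0 scaler0 scale1r !add0r.
apply/asboolP/eqP => [[zeta ->]|]; first by rewrite E.
by case: z => x y /= ->; exists x; rewrite E.
Qed.

Fact Hminus_predP z : (z \in Hminus_pred) = (z.2 == J z.1).
Proof.
have E zeta : iota zeta + 'i *: cext J (iota zeta) = (zeta, J zeta) :> cplx H.
  congr pair => /=; first by rewrite linear0 scale0r scaler0 subr0 addr0.
  by rewrite linear0 scaler0 scale1r !add0r.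
apply/asboolP/eqP => [[zeta ->]|]; first by rewrite E.
by case: z => x y /= ->; exists x; rewrite E.
Qed.

Fact J_linear2 (a b : R) (u v w : H) :
  J (a *: u + b *: v + w) = a *: J u + b *: J v + J w.
Proof. by rewrite linearD linearD 2!linearZ. Qed.

Fact Hplus_closed : submod_closed Hplus_pred.
Proof.
split=> [|c [x x'] [y y']]; first by rewrite Hplus_predP /= linear0 oppr0.
rewrite !Hplus_predP /= => /eqP -> /eqP ->.
rewrite !scalerN opprK J_linear2 J_sqr.
by rewrite scalerN !opprD opprK.
Qed.

Fact Hminus_closed : submod_closed Hminus_pred.
Proof.
split=> [|c [x x'] [y y']]; first by rewrite Hminus_predP /= linear0.
rewrite !Hminus_predP /= => /eqP -> /eqP ->.
by rewrite -scaleNr J_linear2 J_sqr scaleNr scalerN opprK.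
Qed.

HB.instance Definition _ :=
  GRing.isSubmodClosed.Build R[i] (cplx H) Hplus_pred Hplus_closed.
HB.instance Definition _ :=
  GRing.isSubmodClosed.Build R[i] (cplx H) Hminus_pred Hminus_closed.

Definition Hplus : submodClosed (cplx H) :=
  GRing.SubmodClosed.clone R[i] (cplx H) Hplus_pred _.
Definition Hminus : submodClosed (cplx H) :=
  GRing.SubmodClosed.clone R[i] (cplx H) Hminus_pred _.

Section ComplexifiedSubspace.
Variable L : submodClosed H.

Definition csub_pred : pred (cplx H) := fun z => (z.1 \in L) && (z.2 \in L).

Fact csub_closed : submod_closed csub_pred.
Proof.
split=> [|c [x x'] [y y'] /andP[/= ? ?] /andP[/= ? ?]].
  by rewrite unfold_in /= !rpred0.
by rewrite unfold_in /= -scaleNr !rpredD ?rpredZ.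
Qed.

HB.instance Definition _ :=
  GRing.isSubmodClosed.Build R[i] (cplx H) csub_pred csub_closed.

(* The complexification of [L], as a subspace of that of [H]. *)
Definition csub : submodClosed (cplx H) :=
  GRing.SubmodClosed.clone R[i] (cplx H) csub_pred _.
End ComplexifiedSubspace.

Definition unitary (A B : submodClosed (cplx H)) (T : subsp A -> subsp B) :
    Prop :=
  [/\ linear T, bijective T &
      forall z w, cdot (val (T z)) (val (T w)) = cdot (val z) (val w)].

(* [U] is the unitary operator whose graph is [W]. *)
Definition generating_operator (W : submodClosed (cplx H))
    (U : subsp Hplus -> subsp Hminus) : Prop :=
  unitary U /\
  forall z, z \in W <-> exists x : subsp Hplus, z = val x + val (U x).

(* The Hilbert space adjoint, defined pointwise; for an unbounded [A] its value
   is [0] at the points where no such vector exists. *)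
Definition transpose (A : H -> H) (y : H) : H :=
  xget 0 [set z | forall x, dot (A x) y = dot x z]%classic.

Section Splitting.
Variable L : submodClosed H.

(* [x + J y |-> x + i y] for [x] and [y] in [L]. When [L] is Lagrangian,
   [H] is the orthogonal sum of [L] and [J L], so exactly one [w] qualifies and
   the default value is never used. *)
Definition phi (z : H) : subsp (csub L) :=
  xget 0 [set w | exists x y, [/\ x \in L, y \in L, z = x + J y &
                                  val w = iota x + 'i *: iota y]]%classic.

Definition phi_inv (w : subsp (csub L)) : H := (val w).1 + J (val w).2.

Definition phi_star (A : H -> H) : subsp (csub L) -> subsp (csub L) :=
  phi \o A \o phi_inv.

Definition admissible (X Y : H -> H) : Prop :=
  [/\ linear X /\ linear Y,
      {homo X : x / x \in L}, {homo Y : x / x \in L},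
      forall x, X (J x) = J (X x) & forall x, Y (J x) = J (Y x)].

(* The pair [(X, Y)] such that [A = X + J Y]. For Lagrangian [L] and linear
   [A] commuting with [J] it exists and is unique. *)
Definition components (A : H -> H) : (H -> H) * (H -> H) :=
  xget (fun=> 0, fun=> 0)
    [set XY | admissible XY.1 XY.2 /\
              forall z, A z = XY.1 z + J (XY.2 z)]%classic.

Definition transpose_rel (A : H -> H) (z : H) : H :=
  transpose (components A).1 z + J (transpose (components A).2 z).

(* The pair [(X, Y)] such that [T = X + i Y] on the complexification of [L]. *)
Definition ccomponents (T : subsp (csub L) -> subsp (csub L)) :
    (H -> H) * (H -> H) :=
  xget (fun=> 0, fun=> 0)
    [set XY | admissible XY.1 XY.2 /\
              forall w, val (T w) = cext XY.1 (val w) +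
                                    'i *: cext XY.2 (val w)]%classic.

(* [X - i Y] when [T = X + i Y]; it acts on all of [cplx H]. *)
Definition conj_op (T : subsp (csub L) -> subsp (csub L)) (z : cplx H) :
    cplx H :=
  cext (ccomponents T).1 z - 'i *: cext (ccomponents T).2 z.

Definition real_generating_operator (M : submodClosed H) (A : {linear H -> H}) :
    Prop :=
  [/\ forall x, A (J x) = J (A x),
      forall z, z \in M <-> exists2 x, x \in L & z = A (J x) &
      unitary (phi_star A)].

Definition complex_generating_operator (A : H -> H) :
    subsp (csub L) -> subsp (csub L) :=
  phi_star A \o phi_star (transpose_rel A).
End Splitting.
End Symplectic.

Arguments phi {R H} L z.
Arguments phi_star {R H} L A.
Arguments complex_generating_operator {R H} L A.

(* Main.v *)
Require Import Defs.
From HB Require Import structures.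
From mathcomp Require Import all_boot all_order all_algebra sesquilinear complex.
From mathcomp Require Import boolp classical_sets functions reals topology normedtype.

Set Implicit Arguments.
Unset Strict Implicit.
Unset Printing Implicit Defensive.

Import GRing.Theory Num.Theory.
Local Open Scope ring_scope.

(** A Lagrangian subspace L is encoded by its conjugation C, the real linear
    involution x + J y |-> x - J y for x, y in L: it anticommutes with J, and L
    is its set of fixed points.  All operators of the statement are expressed
    through conjugations.

    - If U : H^+ -> H^- has the graph of L complexified, then U maps the point
      of H^+ with first component zeta to the point of H^- with first component
      C zeta ([generating_conjugation]).  The complex linearity of U gives
      C J = - J C, and the graph condition gives the rest; in particular the
      splitting H = L + J L is read off from U.

    - Conjugation by C separates A = X + J Y, where X and Y commute with both C
      and J, into its two parts: C A C = X - J Y.  So X and J Y are the even and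
      odd parts of A ([componentsE]).

    - A real generating operator A of M is an isometry of H onto itself,
      because phi is isometric and phi_* A is unitary; write W for its inverse
      and adjoint.  Transposing the even and odd parts gives
      X^t + J Y^t = C W C ([transpose_rel_inverse]), which is the identity
      (X + i Y)^-1 = X^t - i Y^t in real terms.

    - M = A (J L), and the conjugation of J L is - C, so the conjugation D of M
      satisfies D A = - A C ([real_generating_conjugation]).

    Hence V U^-1 acts on first components as D C = - A C W C = - A A^t, where
    A^t is the transpose relative to L.  On the other side, i (w, J w) is
    (- J w, w), so that X - i Y acts on H^- as X + J Y does on first components
    ([conj_op_phi_star]), and for the complex generating operator this X + J Y
    is A A^t. *)

(** * Inner products and halving *)

Section InnerProduct.
Variables (R : realType) (H : hilbertType R).
Implicit Types x y z : H.

Lemma dotC x y : dot x y = dot y x.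
Proof. by rewrite hermC /= expr0 mul1r. Qed.

Lemma dot_inj y z : (forall x, dot x y = dot x z) -> y = z.
Proof.
move=> yz; apply/eqP; rewrite -subr_eq0 -normr_eq0 -sqrf_eq0 normr_dot.
by rewrite linearBr /= yz subrr.
Qed.

End InnerProduct.

Lemma transposeE (R : realType) (H : symplecticHilbertType R)
    (A B : H -> H) y :
  (forall x, dot (A x) y = dot x (B y)) -> transpose A y = B y.
Proof.
move=> AB; apply: xget_subset1 => //= z z' Hz Hz'; apply: dot_inj => x.
by rewrite -Hz -Hz'.
Qed.

Lemma half_double (R : realType) (V : lmodType R) (x : V) :
  2^-1 *: (x + x) = x.
Proof.
by rewrite -mulr2n -scaler_nat scalerA mulVf ?scale1r // pnatr_eq0.
Qed.

Lemma double_inj (R : realType) (V : lmodType R) (x y : V) :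
  x + x = y + y -> x = y.
Proof. by move=> /(congr1 ( *:%R 2^-1)); rewrite !half_double. Qed.

(** * The conjugation of a Lagrangian subspace *)

Section Conjugation.
Variables (R : realType) (H : symplecticHilbertType R).
Implicit Types (L : submodClosed H) (C : {linear H -> H}).

Definition conjugation L C : Prop :=
  [/\ involutive C, forall x, C (J x) = - J (C x) &
      forall x, x \in L <-> C x = x].

Lemma i_scaleE (z : cplx H) : 'i%C *: z = (- z.2, z.1).
Proof. by congr pair; rewrite /= scale0r scale1r ?sub0r ?add0r. Qed.

Lemma oppr_JB (x y : H) : - J (x - y) = J (y - x).
Proof. by rewrite -[y - x]opprB linearN. Qed.

Lemma Hplus_pair_proof (z : H) : ((z, - J z) : cplx H) \in Hplus H.
Proof. by rewrite Hplus_predP. Qed.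

Definition Hplus_pair (z : H) : subsp (Hplus H) :=
  exist _ (z, - J z) (Hplus_pair_proof z).

Lemma Hplus_pair_fst (x : subsp (Hplus H)) : Hplus_pair (val x).1 = x.
Proof.
apply: val_inj; have := valP x; rewrite Hplus_predP /= => /eqP <-.
exact/esym/surjective_pairing.
Qed.

Lemma csub_pair_proof L x y :
  x \in L -> y \in L -> ((x, y) : cplx H) \in csub L.
Proof. by move=> xL yL; rewrite unfold_in /csub_pred /= xL yL. Qed.

Definition csub_pair L x y (xL : x \in L) (yL : y \in L) : subsp (csub L) :=
  exist _ (x, y) (csub_pair_proof xL yL).

(** A point of H^+ or H^- is determined by its first component, so a linear
    U : H^+ -> H^- is a real linear map C of H. *)
Lemma generating_operator_fst U : linear U ->
  exists C : {linear H -> H},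
    forall x : subsp (Hplus H),
      val (U x : subsp (Hminus H)) = (C (val x).1, J (C (val x).1)).
Proof.
move=> linU.
pose LU : {linear _ -> _} := HB.pack U (GRing.isLinear.Build _ _ _ _ U linU).
pose c z : H := (val (LU (Hplus_pair z))).1.
have lin_c : linear c.
  move=> a x y; rewrite /c.
  have -> : Hplus_pair (a *: x + y) = (a%:C)%C *: Hplus_pair x + Hplus_pair y.
    apply: val_inj; rewrite /=; congr pair => /=.
      by rewrite scale0r subr0.
    by rewrite scale0r addr0 linearD linearZ scalerN opprD.
  by rewrite linearP /= scale0r subr0.
pose C : {linear H -> H} := HB.pack c (GRing.isLinear.Build _ _ _ _ c lin_c).
exists C => x; rewrite /= /c Hplus_pair_fst.
have := valP (U x); rewrite Hminus_predP => /eqP <-.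
exact: surjective_pairing.
Qed.

(** The graph condition says that z + C z and J (C z - z) lie in L for every z,
    and that every x in L is of the form s + C s with C s = s. *)
Lemma generating_conjugation L U : generating_operator (csub L) U ->
  exists2 C, conjugation L C &
    forall x, val (U x) = (C (val x).1, J (C (val x).1)).
Proof.
case=> -[linU bijU _] graphU; have [C UE] := generating_operator_fst linU.
have sumL z : z + C z \in L.
  have : val (Hplus_pair z) + val (U (Hplus_pair z)) \in csub L.
    by apply/graphU; exists (Hplus_pair z).
  by rewrite UE unfold_in => /andP[].
have fixC x : x \in L <-> C x = x.
  split=> [xL|Cx]; last by rewrite -[x]half_double rpredZ // -{2}Cx.
  have /graphU[u] := valP (csub_pair xL (rpred0 L)).
  rewrite UE -[u]Hplus_pair_fst; move: (val u).1 => s [-> e].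
  have Cs : C s = s.
    apply/eqP; rewrite -subr_eq0 -oppr_eq0 -J_sqr linearB.
    by rewrite addrC -e linear0.
  by rewrite linearD !Cs.
exists C => //; split=> // x.
  by have /fixC := sumL x; rewrite linearD [X in _ = X]addrC => /addrI.
(* J on first components is multiplication by i on H^+ and by - i on H^-. *)
pose LU : {linear _ -> _} := HB.pack U (GRing.isLinear.Build _ _ _ _ U linU).
have e : Hplus_pair (J x) = 'i%C *: Hplus_pair x.
  by apply: val_inj; rewrite /= i_scaleE /= opprK J_sqr opprK.
have := congr1 (fun u => (val (LU u)).1) e.
rewrite linearZ [val (_ *: _)]/= i_scaleE [(_, _).1]/=.
by rewrite !UE.
Qed.

(** * Real and imaginary parts relative to a conjugation *)

Section Components.
Variables (L : submodClosed H) (C : {linear H -> H}).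
Hypothesis conjC : conjugation L C.

Let CK : involutive C. Proof. by case: conjC. Qed.
Let CJ x : C (J x) = - J (C x). Proof. by case: conjC. Qed.
Let fixC x : x \in L <-> C x = x. Proof. by case: conjC. Qed.

Lemma conj_split z : exists x y, [/\ x \in L, y \in L & z = x + J y].
Proof.
exists (2^-1 *: (z + C z)), (2^-1 *: J (C z - z)); split.
- by apply/fixC; rewrite linearZ linearD CK addrC.
- by apply/fixC; rewrite linearZ CJ linearB CK oppr_JB.
- by rewrite linearZ J_sqr opprB -scalerDr addrACA subrr addr0 half_double.
Qed.

Lemma conjE x y : x \in L -> y \in L -> C (x + J y) = x - J y.
Proof. by move=> /fixC Cx /fixC Cy; rewrite linearD CJ Cx Cy. Qed.

Lemma split_inj x y x' y' : x \in L -> y \in L -> x' \in L -> y' \in L ->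
  x + J y = x' + J y' -> (x, y) = (x', y').
Proof.
move=> xL yL x'L y'L e; have := congr1 C e; rewrite !conjE // => e'.
have xx' : x = x'.
  apply: double_inj; have := congr2 +%R e e'.
  by rewrite addrACA subrr addr0 => ->; rewrite addrACA subrr addr0.
congr pair => //; move: e; rewrite xx' => /addrI /(congr1 J).
by rewrite !J_sqr => /oppr_inj.
Qed.

Lemma phiE x y : x \in L -> y \in L -> val (phi L (x + J y)) = (x, y).
Proof.
move=> xL yL; rewrite /phi; case: xgetP => [w _ /=|].
  move=> [x' [y' [x'L y'L /split_inj-> // ->]]].
  by rewrite i_scaleE /=; congr pair; rewrite /= ?oppr0 ?addr0 ?add0r.
move=> /(_ (csub_pair xL yL)) []; exists x, y; split=> //=.
by rewrite i_scaleE /=; congr pair; rewrite /= ?oppr0 ?addr0 ?add0r.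
Qed.

Lemma csub_valP (w : subsp (csub L)) : (val w).1 \in L /\ (val w).2 \in L.
Proof. by have := valP w; rewrite unfold_in => /andP. Qed.

Lemma phi_invK : cancel (@phi_inv _ _ L) (phi L).
Proof.
move=> w; apply: val_inj; have [? ?] := csub_valP w.
by rewrite /phi_inv phiE //; case: (val w).
Qed.

Lemma phiK : cancel (phi L) (@phi_inv _ _ L).
Proof.
by move=> z; have [x [y [xL yL ->]]] := conj_split z; rewrite /phi_inv phiE.
Qed.

Lemma phi_star_comp A B : phi_star L A \o phi_star L B = phi_star L (A \o B).
Proof. by apply/funext => w; rewrite /phi_star /= phiK. Qed.

(** The cross terms vanish because L is isotropic. *)
Lemma dot_phi_inv (w w' : subsp (csub L)) : lagrangian L ->
  dot (phi_inv w) (phi_inv w') = complex.Re (cdot (val w) (val w')).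
Proof.
move=> lagL; have [xL yL] := csub_valP w; have [x'L y'L] := csub_valP w'.
rewrite /phi_inv /=; move: (val w).1 (val w).2 (val w').1 (val w').2 xL yL x'L y'L.
move=> x y x' y' xL yL x'L y'L; rewrite linearDl !linearDr /=.
have om u v : u \in L -> v \in L -> dot (J u) v = 0 by move=> /lagL; apply.
rewrite [dot x (J _)]dotC !(om _ _ y'L xL, om _ _ yL x'L) J_skew J_sqr.
by rewrite linearNr /= opprK addr0 add0r.
Qed.

Lemma conj_selfadjoint : lagrangian L -> forall x y, dot (C x) y = dot x (C y).
Proof.
move=> lagL u v.
have [x [y [xL yL ->]]] := conj_split u.
have [x' [y' [x'L y'L ->]]] := conj_split v.
have om a b : a \in L -> b \in L -> dot (J a) b = 0 by move=> /lagL; apply.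
rewrite !conjE // linearBl linearDl !linearDr !linearNr /=.
rewrite ![dot x (J _)]dotC !(om _ _ y'L xL, om _ _ yL x'L).
by rewrite oppr0 !addr0 !add0r.
Qed.

Lemma admissible_conj X Y : admissible L X Y ->
  (forall z, X (C z) = C (X z)) /\ (forall z, Y (C z) = C (Y z)).
Proof.
case=> -[linX linY] XL YL XJ YJ.
pose X' : {linear _ -> _} := HB.pack X (GRing.isLinear.Build _ _ _ _ X linX).
pose Y' : {linear _ -> _} := HB.pack Y (GRing.isLinear.Build _ _ _ _ Y linY).
split=> z; have [x [y [xL yL ->]]] := conj_split z; rewrite conjE //.
  by rewrite -[X]/(X' : _ -> _) linearB linearD /= !XJ conjE ?XL.
by rewrite -[Y]/(Y' : _ -> _) linearB linearD /= !YJ conjE ?YL.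
Qed.

(** The parts of A that commute and anticommute with C are [conj_even A] and
    [J \o conj_odd A]; the factor J is split off so that both [conj_even A] and
    [conj_odd A] commute with C. *)
Definition conj_even (A : H -> H) z : H := 2^-1 *: (A z + C (A (C z))).
Definition conj_odd (A : H -> H) z : H := 2^-1 *: J (C (A (C z)) - A z).

Lemma conj_even_odd A z : A z = conj_even A z + J (conj_odd A z).
Proof.
rewrite /conj_odd linearZ J_sqr opprB -scalerDr addrACA subrr addr0.
by rewrite half_double.
Qed.

Lemma conj_even_odd_admissible (A : {linear H -> H}) :
  (forall x, A (J x) = J (A x)) -> admissible L (conj_even A) (conj_odd A).
Proof.
move=> AJ; split.
- have scaleC a (u : H) : 2^-1 *: (a *: u) = a *: (2^-1 *: u).
    by rewrite !scalerA mulrC.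
  split=> a x y; rewrite /conj_even /conj_odd.
    by rewrite !linearP /= -scaleC -scalerDr addrACA -(scalerDr a).
  have -> : C (A (C (a *: x + y))) - A (a *: x + y) =
      a *: (C (A (C x)) - A x) + (C (A (C y)) - A y).
    by rewrite !(linearP C, linearP A) /= opprD scalerBr addrACA.
  by rewrite [J _]linearP scalerDr scaleC.
- by move=> x /fixC Cx; apply/fixC; rewrite /conj_even linearZ linearD CK !Cx addrC.
- move=> x /fixC Cx; apply/fixC.
  by rewrite /conj_odd linearZ CJ linearB CK !Cx oppr_JB.
- move=> x; rewrite /conj_even AJ CJ linearN AJ linearN CJ opprK -linearD.
  by rewrite -linearZ.
- move=> x; rewrite /conj_odd AJ CJ linearN AJ linearN CJ opprK -linearB.
  by rewrite -!linearZ.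
Qed.

(** If A = X + J Y with X and Y admissible then C A C = X - J Y, so that X and Y
    are recovered from A. *)
Lemma componentsE (A : {linear H -> H}) : (forall x, A (J x) = J (A x)) ->
  components L A = (conj_even A, conj_odd A).
Proof.
move=> AJ; apply: xget_subset1 => /=.
  split; first exact: conj_even_odd_admissible.
  exact: conj_even_odd.
suff uniq X Y : admissible L X Y -> (forall z, A z = X z + J (Y z)) ->
    (X, Y) = (conj_even A, conj_odd A).
  by move=> [X Y] [X' Y'] /= [adm e] [adm' e']; rewrite (uniq X Y) // (uniq X' Y').
move=> adm AE; have [XC YC] := admissible_conj adm.
have CAC z : C (A (C z)) = X z - J (Y z).
  by rewrite AE linearD CJ XC YC !CK.
congr pair; apply/funext => z; rewrite /conj_even /conj_odd CAC AE.
  by rewrite addrACA subrr addr0 half_double.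
have -> : X z - J (Y z) - (X z + J (Y z)) = - J (Y z + Y z).
  by rewrite (linearD J) !opprD addrACA subrr add0r.
by rewrite (linearN J) J_sqr opprK half_double.
Qed.

(** On H^- multiplication by - i is J on first components, so X - i Y becomes
    X + J Y there.  The latter agrees with B on L, hence everywhere. *)
Lemma conj_op_phi_star (B : {linear H -> H}) (w : H) :
  (forall x, B (J x) = J (B x)) ->
  conj_op (phi_star L B) (w, J w) = (B w, J (B w)).
Proof.
move=> BJ; rewrite /conj_op /ccomponents; case: xgetP => [[X Y] _ /= [adm XYE]|].
  suff BE z : B z = X z + J (Y z).
    have [_ _ _ XJ YJ] := adm.
    rewrite i_scaleE /cext /= XJ YJ; congr pair => /=.
      by rewrite opprK BE.
    by rewrite BE linearD J_sqr.
  have [[linX linY] XL YL XJ YJ] := adm.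
  pose X' : {linear _ -> _} := HB.pack X (GRing.isLinear.Build _ _ _ _ X linX).
  pose Y' : {linear _ -> _} := HB.pack Y (GRing.isLinear.Build _ _ _ _ Y linY).
  have BE v : v \in L -> B v = X v + J (Y v).
    move=> vL.
    have -> : B v = phi_inv (phi_star L B (csub_pair vL (rpred0 L))).
      by rewrite /phi_star /= phiK /phi_inv /= linear0 addr0.
    have e w0 : val (phi_star L B w0) = cext X (val w0) + 'i%C *: cext Y (val w0).
      exact: XYE.
    rewrite /phi_inv e i_scaleE /=.
    have -> : X 0 = 0 := linear0 X'.
    have -> : Y 0 = 0 := linear0 Y'.
    by rewrite subr0 add0r.
  have [x [y [xL yL ->]]] := conj_split z.
  rewrite linearD BJ !BE // -[X (_ + _)]/(X' _) -[Y (_ + _)]/(Y' _).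
  rewrite [X' _]linearD [Y' _]linearD /= XJ YJ !linearD !J_sqr.
  by rewrite addrACA.
move=> /(_ (conj_even B, conj_odd B)) []; split=> /=.
  exact: conj_even_odd_admissible.
have [[linX linY] XL YL XJ YJ] := conj_even_odd_admissible BJ.
move=> v; have [] := csub_valP v.
rewrite /phi_star /= {1}/phi_inv -[sval v]/(val v).
case: (val v) => x y /= xL yL; rewrite i_scaleE /cext /=.
have -> : B (x + J y) =
    (conj_even B x - conj_odd B y) + J (conj_odd B x + conj_even B y).
  rewrite linearD BJ [B x]conj_even_odd [B y]conj_even_odd !(linearD J) J_sqr.
  by rewrite [RHS]addrAC !addrA.
rewrite phiE; first by congr pair; rewrite addrC.
  by rewrite -scaleN1r; apply: rpredD; [exact: XL | apply: rpredZ; exact: YL].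
by apply: rpredD; [exact: YL | exact: XL].
Qed.

(** * Real generating operators *)

(** The real part of the unitarity of [phi_star L A] says that A preserves inner
    products; a surjective isometry has its inverse as adjoint. *)
Lemma real_generating_inverse (M : submodClosed H) (A : {linear H -> H}) :
  lagrangian L -> real_generating_operator L M A ->
  exists W : {linear H -> H}, [/\ cancel W A, forall x, W (J x) = J (W x) &
    forall x y, dot (A x) y = dot x (W y)].
Proof.
move=> lagL [AJ _ [_ [g gK Kg] isoA]].
have AE z : A z = phi_inv (phi_star L A (phi L z)) by rewrite /phi_star /= !phiK.
have iso x y : dot (A x) (A y) = dot x y.
  by rewrite !AE dot_phi_inv // isoA -dot_phi_inv // !phiK.
have injA : injective A.
  by move=> x y xy; apply: dot_inj => z; rewrite -(iso z x) -(iso z y) xy.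
pose w z := phi_inv (g (phi L z)).
have wK : cancel w A by move=> z; rewrite AE /w phi_invK Kg phiK.
have linw : linear w by move=> a x y; apply: injA; rewrite linearP /= !wK.
pose W : {linear H -> H} := HB.pack w (GRing.isLinear.Build _ _ _ _ w linw).
exists W; split=> //= [x|x y].
  by apply: injA; rewrite AJ !wK.
by rewrite -[in LHS](wK y) iso.
Qed.

(** C is self-adjoint and J is skew, so the even and odd parts X and Y of A have
    the adjoints [conj_even W] and [- conj_odd W], where W is the adjoint of A.
    The sign turns the sum W of the even and odd parts of W into C W C. *)
Lemma transpose_rel_inverse (A W : {linear H -> H}) : lagrangian L ->
  (forall x, A (J x) = J (A x)) -> (forall x, W (J x) = J (W x)) ->
  (forall x y, dot (A x) y = dot x (W y)) ->
  transpose_rel L A = C \o W \o C.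
Proof.
move=> lagL AJ WJ adj; apply/funext => z; rewrite /transpose_rel componentsE //=.
have selfC := conj_selfadjoint lagL.
rewrite (@transposeE _ _ _ (conj_even W)); last first.
  move=> x; rewrite /conj_even linearZl_LR linearZr_LR /=; congr (_ * _).
  by rewrite linearDl linearDr /= selfC !adj selfC.
rewrite (@transposeE _ _ _ (fun y => - conj_odd W y)); last first.
  move=> x; rewrite /conj_odd linearZl_LR linearNr linearZr_LR /=.
  rewrite -mulrN; congr (_ * _); rewrite J_skew linearBl /= selfC !adj selfC.
  rewrite WJ CJ linearN WJ linearN CJ /= opprK.
  by rewrite linearB linearBr /=.
rewrite /conj_even /conj_odd (linearN J) [J (_ *: _)]linearZ /= J_sqr.
by rewrite scalerN opprK -scalerDr addrC addrA subrK half_double.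
Qed.

End Components.
End Conjugation.

(** A carries J L to M and, commuting with J, carries L to J M; D is the
    identity on M and its opposite on J M. *)
Lemma real_generating_conjugation (R : realType) (H : symplecticHilbertType R)
    (L M : submodClosed H) (C D A : {linear H -> H}) :
  conjugation L C -> conjugation M D -> real_generating_operator L M A ->
  forall u, D (A u) = - A (C u).
Proof.
move=> [CK CJ fixC] conjD [AJ AM _] u.
have [DK DJ fixD] := conjD.
have DAJ x : x \in L -> D (A (J x)) = A (J x).
  by move=> xL; apply/fixD/AM; exists x.
have [x [y [xL yL ->]]] : exists x y, [/\ x \in L, y \in L & u = x + J y].
  by apply: (conj_split (C := C)).
have DA : D (A x) = - A x.
  have : - J (D (A x)) = J (A x) by rewrite -DJ -AJ DAJ.
  by move=> /(congr1 J); rewrite linearN !J_sqr opprK.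
rewrite !(linearD A) (linearD D) DA DAJ // (linearD C) CJ.
have /fixC -> := xL; have /fixC -> := yL.
by rewrite (linearB A) opprB addrC.
Qed.

Theorem lemma11 (R : realType) (H : symplecticHilbertType R)
    (lambda mu : submodClosed H)
    (hlambda : lagrangian lambda) (hmu : lagrangian mu)
    (Vt : {linear H -> H}) (hVt : real_generating_operator lambda mu Vt)
    (U V : subsp (Hplus H) -> subsp (Hminus H))
    (hU : generating_operator (csub lambda) U)
    (hV : generating_operator (csub mu) V) :
  forall z : subsp (Hminus H),
    val (V ('pinv_(fun=> 0) setT U z)) =
      - conj_op (complex_generating_operator lambda Vt) (val z).
Proof.
move=> z.
have [C conjC UE] := generating_conjugation hU.
have [D conjD VE] := generating_conjugation hV.
have [CK CJ _] := conjC.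
have [VtJ _ _] := hVt.
have [W [WK WJ adj]] := real_generating_inverse conjC hlambda hVt.
have DVt := real_generating_conjugation conjC conjD hVt.
set x := 'pinv_(fun=> 0) setT U z.
have Ux : U x = z.
  apply: pinvK; rewrite inE; have [[_ [g _ Kg] _] _] := hU.
  by exists (g z).
rewrite /complex_generating_operator.
rewrite (transpose_rel_inverse conjC hlambda VtJ WJ adj) (phi_star_comp conjC).
rewrite -Ux UE VE.
rewrite (conj_op_phi_star conjC (B := Vt \o ((C \o W) \o C))) /=; last first.
  by move=> y; rewrite CJ (linearN W) WJ (linearN C) CJ opprK VtJ.
rewrite CK; set u := (val x).1.
have -> : D u = - Vt (C (W u)) by rewrite -DVt WK.
by rewrite (linearN J).
Qed.
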